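(* Let $m,n\ge1$. The upper ideal generated by the $(n,m)$-comb in the Tamari lattice of binary trees of size $n\times m$ is the set of all $m$-binary trees of size $n\times m$.
   Context: Binary trees are planar: either empty or a root node with an ordered pair (left subtree, right subtree); $x(A,B)$ denotes the tree with root $x$ and left/right subtrees $A,B$; size is the number of nodes. The Tamari order on binary trees of a given size is the reflexive transitive closure of right rotation, which replaces a subtree $y(x(A,B),C)$ by $x(A,y(B,C))$ (result greater). The upper ideal generated by $C$ is $\{T: T\ge C\}$. The $(n,m)$-comb is the left comb of $n$ right combs of size $m$: $C_0=\emptyset$, and $C_n$ is the tree whose left subtree is $C_{n-1}$ and whose right subtree is the right comb with $m-1$ nodes (the tree with $m-1$ nodes in which no node has a left child). $m$-binary trees: a binary tree $T$ is an $m$-binary tree if it is empty or is built as follows from $m$-binary trees $T_L,T_{R_1},\dots,T_{R_m}$. Set $G_m:=T_{R_m}$; for $i=m-1,\dots,1$ let $G_i$ be obtained from $T_{R_i}$ by grafting, as the left child of its leftmost node, the tree with a new root node, empty left subtree and right subtree $G_{i+1}$ (if $T_{R_i}$ is empty, $G_i$ is this grafted tree itself); then $T$ is the tree with a new root, left subtree $T_L$ and right subtree $G_1$. An $m$-binary tree has size $nm$ for some $n\ge0$. *)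

(* Defs.v *)
From Stdlib Require Import Relation_Operators.
From mathcomp Require Import all_boot.
Set Implicit Arguments.
Unset Strict Implicit.
Unset Printing Implicit Defensive.

Inductive btree : Type :=
| Empty
| Node of btree & btree.

Fixpoint btree_size (T : btree) : nat :=
  if T is Node L R then (btree_size L + btree_size R).+1 else 0.

Inductive right_rotation : btree -> btree -> Prop :=
| RotRoot A B C :
    right_rotation (Node (Node A B) C) (Node A (Node B C))
| RotLeft L L' R : right_rotation L L' -> right_rotation (Node L R) (Node L' R)
| RotRight L R R' : right_rotation R R' -> right_rotation (Node L R) (Node L R').

Definition tamari_le : btree -> btree -> Prop :=
  clos_refl_trans btree right_rotation.

Definition tamari_upper_ideal (N : nat) (C T : btree) : Prop :=
  btree_size T = N /\ tamari_le C T.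

Fixpoint right_comb (k : nat) : btree :=
  if k is k'.+1 then Node Empty (right_comb k') else Empty.

Fixpoint comb (n m : nat) : btree :=
  if n is n'.+1 then Node (comb n' m) (right_comb m.-1) else Empty.

(* The leftmost node is the one reached from the root by following left
   children; [graft_left U Empty] is [U]. *)
Fixpoint graft_left (U T : btree) : btree :=
  if T is Node L R then Node (graft_left U L) R else U.

(* On [:: R_1; ...; R_m] this is G_1; the recursive calls on the successive
   tails give G_2, ..., G_m = R_m. The value on [::] is irrelevant for m >= 1. *)
Fixpoint right_part (Rs : seq btree) : btree :=
  match Rs with
  | [::] => Empty
  | [:: R] => R
  | R :: Rs' => graft_left (Node Empty (right_part Rs')) R
  end.

Inductive m_binary (m : nat) : btree -> Prop :=
| MBinaryEmpty : m_binary m Empty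
| MBinaryNode (TL : btree) (Rs : seq btree) :
    m_binary m TL ->
    size Rs = m ->
    (forall i, i < m -> m_binary m (nth Empty Rs i)) ->
    m_binary m (Node TL (right_part Rs)).

Lemma tamari_le_size (T T' : btree) :
  tamari_le T T' -> btree_size T' = btree_size T.
Proof.
elim=> // [{}T {}T' | ? ? ? _ <- _ -> //].
by elim=> [A B C|L L' R _ IH|L R R' _ IH] /=; rewrite ?IH ?addSn ?addnS ?addnA.
Qed.

Lemma btree_size_comb (n m : nat) : 0 < m -> btree_size (comb n m) = n * m.
Proof.
move=> m_gt0; have rcE k : btree_size (right_comb k) = k by elim: k => //= k ->.
by elim: n => //= n ->; rewrite rcE -addnS prednK // mulSn addnC.
Qed.

(* Main.v *)
From Stdlib Require Import Relation_Operators.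
Require Import Defs.
From mathcomp Require Import all_boot.
Set Implicit Arguments.
Unset Strict Implicit.
Unset Printing Implicit Defensive.

(** Write m = p + 1.  The definition of m-binary trees passes through the
    auxiliary trees G_m, ..., G_1, and the proof consists in following all of
    these at once: [pending p j] is the class of the trees that may occur as
    G_(m - j), so that j = 0 gives the m-binary trees ([pending0P]) and j = p
    the right subtrees of their nodes.  Unfolding the grafts from the bottom of
    the left branch turns this family into a plain structural recursion on
    binary trees, in which neither grafting nor lists of subtrees remain.

    In this form each inclusion is a short induction.  A right rotation
    preserves [pending p j] for every j ([pending_right_rotation]), and the comb
    lies in [pending p 0]; hence every tree above the comb is m-binary.
    Conversely, a tree in [pending p j] lies above a comb at whose leftmost
    position a right comb with j nodes has been grafted ([comb_le_pending]): the
    subtrees do so by induction, and the combs found there are merged into a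
    single one by undoing right rotations along a left branch
    ([graft_left_rotate]).  For j = 0 the graft is empty, the tree is above some
    comb, and the sizes decide which one. *)

(** The trees G_(p + 1 - j).  A node on the left branch either belongs to
    T_(R_i), and then its right subtree is a G_1, or it is the bottom node
    grafted by the construction, and then its right subtree is the next G. *)
Inductive pending (p : nat) : nat -> btree -> Prop :=
| PendingEmpty : pending p 0 Empty
| PendingNode j L R : pending p j L -> pending p p R -> pending p j (Node L R)
| PendingGraft j G : pending p j G -> pending p j.+1 (Node Empty G).

Section Pending.

Variable p : nat.

Lemma pending_graft_left j U T :
  pending p 0 T -> pending p j U -> pending p j (graft_left U T).
Proof.
move=> T_bin U_j; elim: T T_bin => [//|L IHL R _ LR_bin] /=.
by inversion LR_bin; apply: PendingNode => //; apply: IHL.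
Qed.

Lemma pending_right_part j Rs :
  size Rs = j.+1 -> (forall i, i < j.+1 -> pending p 0 (nth Empty Rs i)) ->
  pending p j (right_part Rs).
Proof.
elim: j Rs => [|j IHj] [|R [|R' Rs]] //= size_Rs Rs_bin; first exact: Rs_bin 0 _.
apply: pending_graft_left; first exact: Rs_bin 0 _.
by apply/PendingGraft/(IHj (R' :: Rs)) => [|i lt_i_j]; [case: size_Rs => <- | apply: Rs_bin i.+1 _].
Qed.

(** The converse of [pending_right_part].  A node above [right_part (R0 :: Rs)]
    is absorbed by R0, the tree at the top of the left branch, whereas a grafted
    bottom node begins a new list entry, which is so far empty. *)
Lemma pending_right_partP j T :
  pending p j T ->
  exists Rs, [/\ size Rs = j.+1,
    forall i, i < j.+1 -> m_binary p.+1 (nth Empty Rs i) & T = right_part Rs].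
Proof.
elim=> [|{}j L R _ [[|R0 Rs] [//= size_Rs Rs_bin ->]] _ [Rs' [size_Rs' Rs'_bin ->]]
        |{}j G _ [Rs [size_Rs Rs_bin ->]]].
- by exists [:: Empty]; split=> // -[] // _; apply: MBinaryEmpty.
- exists (Node R0 (right_part Rs') :: Rs); split=> //.
    move=> [_|i /Rs_bin //]; apply: MBinaryNode => //; exact: Rs_bin 0 _.
  by case: (Rs).
- exists (Empty :: Rs); split=> [|[_|i /Rs_bin //]|]; first by rewrite /= size_Rs.
    exact: MBinaryEmpty.
  by case: Rs size_Rs {Rs_bin}.
Qed.

Lemma pending0P T : m_binary p.+1 T <-> pending p 0 T.
Proof.
split=> [|/pending_right_partP[[|R [|R' Rs]] [// _ R_bin ->]]]; last exact: R_bin 0 _.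
elim=> [|TL Rs _ TL_bin size_Rs _ Rs_bin]; first exact: PendingEmpty.
exact: PendingNode TL_bin (pending_right_part size_Rs Rs_bin).
Qed.

(** At the root the rotation turns y(x(A, B), C) into x(A, y(B, C)).  The tree C
    is a G_1 and x may be of either kind; it remains of that kind, since its
    right subtree B, whatever its index, keeps that index when it becomes the
    left subtree of the node y, whose right subtree is still C. *)
Lemma pending_right_rotation j T T' :
  right_rotation T T' -> pending p j T -> pending p j T'.
Proof.
move=> rot; elim: rot j => [A B C|L L' R rotL IHL|L R R' _ IHR] j T_j.
- inversion T_j as [|? ? ? AB_j C_p|]; subst.
  inversion AB_j as [|? ? ? A_j B_p|? ? B_j]; subst.
    exact: PendingNode A_j (PendingNode B_p C_p).
  exact: PendingGraft (PendingNode B_j C_p).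
- inversion T_j as [|? ? ? L_j R_p|]; subst; last by inversion rotL.
  exact: PendingNode (IHL _ L_j) R_p.
- inversion T_j as [|? ? ? L_j R_p|? ? R_j]; subst.
    exact: PendingNode L_j (IHR _ R_p).
  exact: PendingGraft (IHR _ R_j).
Qed.

Lemma pending_tamari_le j T T' :
  tamari_le T T' -> pending p j T -> pending p j T'.
Proof.
elim=> [{}T {}T' /pending_right_rotation|//|T1 T2 T3 _ IH12 _ IH23 /IH12 /IH23 //].
exact.
Qed.

Lemma pending_right_comb k : pending p k (right_comb k).
Proof. by elim: k => [|k IHk] /=; [apply: PendingEmpty | apply: PendingGraft]. Qed.

Lemma pending_comb n : pending p 0 (comb n p.+1).
Proof.
elim: n => [|n IHn] /=; first exact: PendingEmpty.
exact: PendingNode IHn (pending_right_comb p).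
Qed.

End Pending.

Lemma tamari_le_Node L L' R R' :
  tamari_le L L' -> tamari_le R R' -> tamari_le (Node L R) (Node L' R').
Proof.
move=> leL leR; apply: (@rt_trans _ _ _ (Node L' R)).
  elim: leL => [T T' rot|T|T1 T2 T3 _ le12 _ le23]; last exact: rt_trans le12 le23.
    exact/rt_step/RotLeft.
  exact: rt_refl.
elim: leR => [T T' rot|T|T1 T2 T3 _ le12 _ le23]; last exact: rt_trans le12 le23.
  exact/rt_step/RotRight.
exact: rt_refl.
Qed.

(** A node with right subtree [graft_left B C] is brought down to the bottom of
    the left branch of C by undoing one rotation for each node of this branch. *)
Lemma graft_left_rotate A B C :
  tamari_le (graft_left (Node A B) C) (Node A (graft_left B C)).
Proof.
elim: C => [|L IHL R _] /=; first exact: rt_refl.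
apply: rt_trans (rt_step _ _ _ _ (RotRoot _ _ _)).
exact: tamari_le_Node IHL (rt_refl _ _ _).
Qed.

Lemma graft_left_comb U m a b :
  graft_left (graft_left U (comb a m)) (comb b m) = graft_left U (comb (b + a) m).
Proof. by elim: b => //= b ->. Qed.

Lemma graft_left_Empty T : graft_left Empty T = T.
Proof. by elim: T => //= L -> R _. Qed.

(** The number of teeth is left open because it differs between the subtrees, and
    the grafted right comb records the bottom nodes still to be completed into a
    tooth: each [PendingGraft] node lengthens it by one. *)
Lemma comb_le_pending p j T :
  pending p j T ->
  exists N, tamari_le (graft_left (right_comb j) (comb N p.+1)) T.
Proof.
elim=> [|{}j L R _ [a leL] _ [b leR]|{}j G _ [N leG]].
- by exists 0; apply: rt_refl.
- (* The root carries the right comb of size p left at the bottom of the lower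
     bound for R; moved to the bottom, it becomes one more tooth, on top of
     the lower bound for L. *)
  exists (b + a.+1); rewrite -graft_left_comb /=.
  exact: rt_trans (graft_left_rotate _ _ _) (tamari_le_Node leL leR).
- exists N.
  exact: rt_trans (graft_left_rotate _ _ _) (tamari_le_Node (rt_refl _ _ _) leG).
Qed.

Theorem proposition4p3 (m n : nat) (hm : 1 <= m) (hn : 1 <= n) (T : btree) :
  tamari_upper_ideal (n * m) (comb n m) T <->
  btree_size T = n * m /\ m_binary m T.
Proof.
case: m hm => // p _; split=> [[size_T le_T]|[size_T /pending0P T_bin]].
  by split=> //; apply/pending0P/(pending_tamari_le le_T)/pending_comb.
split=> //; have [N] := comb_le_pending T_bin.
rewrite graft_left_Empty => le_T.
suff -> : n = N by [].
apply/eqP; rewrite -(@eqn_pmul2r p.+1) // -size_T.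
by rewrite (tamari_le_size le_T) btree_size_comb.
Qed.
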